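(* Let $A,B\in\mathbb{R}^{m\times n}$, $c\in\mathbb{R}^m$, $T=[\,A+B\;\;\;-A+B\,]\in\mathbb{R}^{m\times2n}$, and fix $\gamma\in(0,1)$. Let $\{w^k\}_{k=0}^\infty$ be a sequence generated by $$w^{k+1}\in(1-\gamma)P_{C_2}(w^k)+\gamma(P_{C_1}\circ P_{C_2})(w^k),\quad k\ge0,$$ in the sense that for each $k$ there is $\bar w^{k}_{\ast}\in P_{C_2}(w^k)$ with $w^{k+1}=(1-\gamma)\bar w^{k}_{\ast}+\gamma P_{C_1}(\bar w^{k}_{\ast})$, with initial point $w^0=(1-\gamma)\bar w^0+\gamma P_{C_1}(\bar w^0)$ for some $\bar w^0\in C_2$. If $\{w^k\}_{k=0}^\infty$ is bounded, then there exists $\bar w^*=(\bar u^*,\bar v^* )\in C_2$ such that $w^k\to w^*$, where $w^*=(1-\gamma)\bar w^*+\gamma P_{C_1}(\bar w^* )$. Moreover, if $$\operatorname{Ker}(T)^{\perp}\cap\{w=(u,v)\in\mathbb{R}^n\times\mathbb{R}^n:u_iv_i=0\ \ \forall i=1,\dots,n\}=\{0\}$$ and $(\bar u_i^*,\bar v_i^* )\ne(0,0)$ for all $i=1,\dots,n$, then $w^*\in C_1\cap C_2$.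
   Context: $C_1:=\{w\in\mathbb{R}^n\times\mathbb{R}^n: Tw=\sqrt2\,c\}$ and $C_2:=\{w=(u,v)\in\mathbb{R}^n\times\mathbb{R}^n: u\ge 0,\ v\ge 0,\ \langle u,v\rangle=0\}$ (inequalities componentwise). For a set $S$, $P_S(z):=\{s\in S:\|s-z\|\le\|t-z\|\ \forall t\in S\}$ is the (possibly multivalued) Euclidean metric projector; $P_{C_1}$ is single-valued when $C_1\neq\emptyset$ (as is implicit in the existence of $w^0$). *)

(* Defs.v *)
From HB Require Import structures.
From mathcomp Require Import all_boot all_order all_algebra.
From mathcomp Require Import all_classical all_reals all_analysis.

Set Implicit Arguments.
Unset Strict Implicit.
Unset Printing Implicit Defensive.

Import Order.TTheory GRing.Theory Num.Theory.
Import numFieldNormedType.Exports.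

Local Open Scope classical_set_scope.
Local Open Scope ring_scope.

(* A pair w = (u, v) in R^n x R^n is the stacked column w : 'cV[R]_(n + n), with
   u = usubmx w and v = dsubmx w. *)

Definition dotv (R : realType) (p : nat) (x y : 'cV[R]_p) : R :=
  \sum_(i < p) x i 0 * y i 0.

(* The library norm `|x| on matrices is the max norm (it induces the usual
   topology and the usual bounded sets, but not the Euclidean projector). *)
Definition enorm (R : realType) (p : nat) (x : 'cV[R]_p) : R :=
  Num.sqrt (dotv x x).

(* As a set: possibly empty, possibly with several elements. *)
Definition metric_proj (R : realType) (p : nat) (S : set 'cV[R]_p)
    (z : 'cV[R]_p) : set 'cV[R]_p :=
  [set s | S s /\ forall t, S t -> enorm (s - z) <= enorm (t - z)].

(* (1 - g) z + g P_S(z), as a set; it is a singleton when P_S(z) is, in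
   particular when S is a nonempty affine subspace. *)
Definition relaxed_proj (R : realType) (p : nat) (g : R) (S : set 'cV[R]_p)
    (z : 'cV[R]_p) : set 'cV[R]_p :=
  [set (1 - g) *: z + g *: s | s in metric_proj S z].

Definition Tmx (R : realType) (m n : nat) (A B : 'M[R]_(m, n)) :
    'M[R]_(m, n + n) :=
  row_mx (A + B) (- A + B).

Definition C1 (R : realType) (m n : nat) (A B : 'M[R]_(m, n)) (c : 'cV[R]_m) :
    set 'cV[R]_(n + n) :=
  [set w | Tmx A B *m w = Num.sqrt 2 *: c].

Definition C2 (R : realType) (n : nat) : set 'cV[R]_(n + n) :=
  [set w | [/\ forall i, 0 <= usubmx w i 0,
               forall i, 0 <= dsubmx w i 0
             & dotv (usubmx w) (dsubmx w) = 0]].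

(* Not the library's kermx, which is the left kernel {x | x *m M = 0}. *)
Definition kerset (R : realType) (m p : nat) (M : 'M[R]_(m, p)) : set 'cV[R]_p :=
  [set x | M *m x = 0].

Definition ortho_compl (R : realType) (p : nat) (S : set 'cV[R]_p) : set 'cV[R]_p :=
  [set x | forall y, S y -> dotv x y = 0].

(* Main.v *)
Require Import Defs.
From HB Require Import structures.
From mathcomp Require Import all_boot all_order all_algebra.
From mathcomp Require Import all_classical all_reals all_analysis.
From mathcomp Require Import ring lra.

Import Order.TTheory GRing.Theory Num.Theory.
Import numFieldNormedType.Exports.

Local Open Scope classical_set_scope.
Local Open Scope ring_scope.

(** Write [P] for the projector on the affine set [C1] and
    [G x = (1 - gamma) x + gamma P x].  The projected points [z k] in [C2] with
    [w k.+1 = G (z k)] satisfy [z k.+1] in the metric projection of [G (z k)] on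
    [C2]: this is a projected gradient method of step [gamma < 1] for half of
    the squared distance to [C1], on the nonconvex set [C2].  Two facts make
    the whole sequence converge.

    - Since [gamma < 1], one step lowers the squared distance to [C1] by at
      least a constant times the square of its length ([relaxed_descent]);
      hence the step lengths tend to 0 ([descent_steps_cvg0]).
    - [C2] is a finite union of coordinate faces of the nonnegative orthant.
      Any selection of its multivalued projector acts, at each point, as the
      projector on one of these faces ([metric_proj_C2]), and each of them is
      nonexpansive.  So [z k.+1] is the image of [z k] by one of finitely many
      nonexpansive maps.

    By boundedness [z] has a cluster point [zs].  A map of the family that
    moves [zs] moves every point near [zs] by a distance bounded below, so it
    cannot be one of the late short steps taken near [zs].  Near [zs] only maps
    fixing [zs] are therefore applied; being nonexpansive they never increase
    the distance to [zs], and a cluster point is then a limit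
    ([union_nonexpansive_cvg]).  Continuity of [G] gives the limit [G zs] of
    [w].

    For the second part, [zs] is fixed by one of these maps, that is, by
    [y |-> y - gamma (y - P y)] followed by truncation to the nonnegative
    orthant and to some face.  At a positive coordinate of [zs] truncation is
    inactive, so [zs - P zs] vanishes there.  If each pair [(u_i, v_i)] has a
    positive entry, then [zs - P zs], which is orthogonal to the kernel,
    satisfies [u_i v_i = 0] for all [i], hence is 0, and [G zs = zs = P zs]. *)

Set Implicit Arguments.
Unset Strict Implicit.

(** * Inner product and squared Euclidean norm *)

(** Working with squares keeps all estimates polynomial, hence within reach of
    linear arithmetic once inner products are expanded by [dotvE]. *)
Notation sqn x := (dotv x x).

Lemma dotvC (R : realType) (p : nat) (x y : 'cV[R]_p) : dotv x y = dotv y x.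
Proof. by apply: eq_bigr => i _; rewrite mulrC. Qed.

Lemma dotvDl (R : realType) (p : nat) (x y z : 'cV[R]_p) :
  dotv (x + y) z = dotv x z + dotv y z.
Proof.
by rewrite /dotv -big_split; apply: eq_bigr => i _; rewrite mxE mulrDl.
Qed.

Lemma dotvZl (R : realType) (p : nat) (a : R) (x y : 'cV[R]_p) :
  dotv (a *: x) y = a * dotv x y.
Proof.
by rewrite /dotv mulr_sumr; apply: eq_bigr => i _; rewrite mxE mulrA.
Qed.

Lemma dotvDr (R : realType) (p : nat) (x y z : 'cV[R]_p) :
  dotv z (x + y) = dotv z x + dotv z y.
Proof. by rewrite ![dotv z _]dotvC dotvDl. Qed.

Lemma dotvZr (R : realType) (p : nat) (a : R) (x y : 'cV[R]_p) :
  dotv y (a *: x) = a * dotv y x.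
Proof. by rewrite ![dotv y _]dotvC dotvZl. Qed.

Lemma dotvNl (R : realType) (p : nat) (x y : 'cV[R]_p) :
  dotv (- x) y = - dotv x y.
Proof. by rewrite -scaleN1r dotvZl mulN1r. Qed.

Lemma dotvNr (R : realType) (p : nat) (x y : 'cV[R]_p) :
  dotv y (- x) = - dotv y x.
Proof. by rewrite ![dotv y _]dotvC dotvNl. Qed.

Definition dotvE := (dotvDl, dotvDr, dotvNl, dotvNr, dotvZl, dotvZr).

Lemma dotv_trmx (R : realType) (p : nat) (x y : 'cV[R]_p) :
  dotv x y = (x^T *m y) 0 0.
Proof. by rewrite mxE; apply: eq_bigr => i _; rewrite mxE. Qed.

Lemma sqn_ge0 (R : realType) (p : nat) (x : 'cV[R]_p) : 0 <= sqn x.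
Proof. by apply: sumr_ge0 => i _; rewrite -expr2 sqr_ge0. Qed.

Lemma sqn_coord_le (R : realType) (p : nat) (x : 'cV[R]_p) i :
  x i 0 ^+ 2 <= sqn x.
Proof.
rewrite /dotv (bigD1 i) //= -expr2 lerDl.
by apply: sumr_ge0 => j _; rewrite -expr2 sqr_ge0.
Qed.

Lemma sqn_eq0 (R : realType) (p : nat) (x : 'cV[R]_p) : sqn x <= 0 -> x = 0.
Proof.
move=> x0; apply/matrixP => i j; rewrite (ord1 j) !mxE; apply/eqP.
rewrite -sqrf_eq0 eq_le sqr_ge0 andbT.
exact: le_trans (sqn_coord_le _ i) x0.
Qed.

Lemma sqn_subC (R : realType) (p : nat) (x y : 'cV[R]_p) :
  sqn (x - y) = sqn (y - x).
Proof. by rewrite -opprB dotvNl dotvNr opprK. Qed.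

Lemma sqn_convex (R : realType) (p : nat) (a : R) (x y : 'cV[R]_p) :
  0 <= a <= 1 ->
  sqn ((1 - a) *: x + a *: y) <= (1 - a) * sqn x + a * sqn y.
Proof.
move=> /andP[a0 a1].
have : 0 <= a * (1 - a) * sqn (x - y) by rewrite !mulr_ge0 ?sqn_ge0 ?subr_ge0.
rewrite !dotvE (dotvC y x); lra.
Qed.

Lemma sqn_add3 (R : realType) (p : nat) (x y z : 'cV[R]_p) :
  sqn (x + y + z) <= 3 * (sqn x + sqn y + sqn z).
Proof.
have := sqn_ge0 (x - y); have := sqn_ge0 (x - z).
have := sqn_ge0 (y - z).
rewrite !dotvE (dotvC y x) (dotvC z x) (dotvC z y); lra.
Qed.

(** * Squared Euclidean norm and topology *)

Lemma cvg_sqn (R : realType) (p : nat) (x : nat -> 'cV[R]_p) (xs : 'cV[R]_p) :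
  (forall e, 0 < e -> \forall k \near \oo, sqn (x k - xs) < e) ->
  x @ \oo --> xs.
Proof.
move=> xP; apply/cvg_ballP => e e0.
have e20 : 0 < e ^+ 2 by rewrite exprn_gt0.
apply: filterS (xP _ e20) => k xk; split=> // i j; rewrite (ord1 j) /ball /=.
rewrite -(@ltr_pXn2r _ 2) ?nnegrE ?normr_ge0 ?(ltW e0)// real_normK ?num_real//.
apply: le_lt_trans xk; rewrite sqn_subC.
by have := sqn_coord_le (xs - x k) i; rewrite !mxE.
Qed.

(** Bolzano-Weierstrass, with the cluster point expressed by the Euclidean
    norm. *)
Lemma bounded_sqn_cluster (R : realType) (p : nat) (z : nat -> 'cV[R]_p)
    (M : R) :
  (forall k i, `|z k i 0| <= M) ->
  exists zs, forall e N, 0 < e -> exists2 k, (N <= k)%N & sqn (z k - zs) < e.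
Proof.
move=> zM.
have := @rV_compact R p (fun=> `[- M, M]%classic)
  (fun=> @segment_compact R (- M) M).
move=> /(_ ((fun k => (z k)^T) @ \oo) _) [].
  exists 0%N => // k _ i; rewrite mxE /= in_itv /=.
  by rewrite -ler_norml.
move=> x [_ xcl]; exists x^T => e N e0.
(* In a ball of radius d, each squared coordinate is at most d * 1. *)
pose d := Num.min 1 (e / p.+1%:R).
have d0 : 0 < d by rewrite lt_min ltr01 divr_gt0.
have [||y [[k /= Nk <-] [_ ky]]] := xcl [set (z k)^T | k in [set k | N <= k]%N]
  (ball x d).
- by exists N => // k /= Nk; exists k.
- exact: nbhsx_ballx.
exists k => //.
apply: (@le_lt_trans _ _ (\sum_(i < p) (e / p.+1%:R))).
  apply: ler_sum => i _; rewrite !mxE.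
  have := ky 0 i; rewrite /ball /= mxE lt_min => /andP[k1 k2].
  rewrite -expr2 -[X in X <= _]real_normK ?num_real// distrC expr2.
  apply: le_trans (ltW k2); rewrite ler_piMl//; exact: ltW.
rewrite sumr_const card_ord -[X in X < _]mulr_natr mulrAC ltr_pdivrMr ?ltr0n//.
by rewrite ltr_pM2l// ltr_nat.
Qed.

(** * Iterating finitely many nonexpansive maps *)

(** As [I] is finite, some [d > 0] is a lower bound of [sqn (F i zs - zs)] over
    the [F i] that move [zs].  By the triangle inequality such an [F i] moves
    all points near [zs] by an amount comparable to [d], against the smallness
    of late steps.  So, late and near [zs], the maps applied fix [zs], and the
    distance to [zs] no longer increases. *)
Lemma union_nonexpansive_cvg (R : realType) (p : nat) (I : finType)
    (F : I -> 'cV[R]_p -> 'cV[R]_p) (j : nat -> I) (z : nat -> 'cV[R]_p)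
    (zs : 'cV[R]_p) :
  (forall i x y, sqn (F i x - F i y) <= sqn (x - y)) ->
  (forall k, z k.+1 = F (j k) (z k)) ->
  (forall e, 0 < e -> \forall k \near \oo, sqn (z k.+1 - z k) < e) ->
  (forall e N, 0 < e -> exists2 k, (N <= k)%N & sqn (z k - zs) < e) ->
  (forall e, 0 < e -> \forall k \near \oo, sqn (z k - zs) < e) /\
  (exists k, F (j k) zs = zs).
Proof.
move=> Fne zF zstep zcl.
have [d d0 dP] : exists2 d, 0 < d &
    forall i, F i zs != zs -> d <= sqn (F i zs - zs).
  exists (\big[Num.min/1]_(i | F i zs != zs) sqn (F i zs - zs)).
    apply: lt_bigmin => // i Fi; rewrite lt_neqAle sqn_ge0 andbT.
    apply: contra_neq Fi => /esym Fi.
    by apply/subr0_eq/sqn_eq0; rewrite Fi.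
  by move=> i Fi; apply: bigmin_le_cond.
(* F zs - zs is the sum of F zs - F x, F x - x and x - zs, so its square is at
   most 3 times the sum of theirs, hence below 9 * (d / 9). *)
have d90 : 0 < d / 9 by rewrite divr_gt0.
have [N _ NP] := zstep _ d90.
have fix_near k : (N <= k)%N -> sqn (z k - zs) < d / 9 -> F (j k) zs = zs.
  move=> Nk zk; apply/eqP/negPn/negP => /dP.
  have := sqn_add3 (F (j k) zs - F (j k) (z k)) (F (j k) (z k) - z k)
    (z k - zs).
  rewrite !addrA !subrK.
  have := Fne (j k) zs (z k); rewrite (sqn_subC zs).
  have := NP k Nk; rewrite /= zF; lra.
have stay e : 0 < e -> e <= d / 9 -> exists2 K, (N <= K)%N &
    forall k, (K <= k)%N -> sqn (z k - zs) < e.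
  move=> e0 ed; have [K NK Ke] := zcl e N e0; exists K => // k.
  elim: k => [|k IHk]; first by rewrite leqn0 => /eqP K0; move: Ke; rewrite K0.
  rewrite leq_eqVlt => /orP[/eqP <- //|]; rewrite ltnS => Kk.
  have {}IHk := IHk Kk.
  have := Fne (j k) (z k) zs.
  rewrite -zF (fix_near k (leq_trans NK Kk) (lt_le_trans IHk ed)) => Fk.
  exact: le_lt_trans Fk IHk.
split; last first.
  have [K NK KP] := stay _ d90 (lexx _).
  by exists K; apply: fix_near => //; apply: KP.
move=> e e0.
have [||K _ KP] := stay (Num.min e (d / 9)).
- by rewrite lt_min e0.
- by rewrite ge_min lexx orbT.
exists K => // k /= /KP; by rewrite lt_min => /andP[].
Qed.

(** * Metric projectors *)

Lemma metric_proj_sqn (R : realType) (p : nat) (S : set 'cV[R]_p) z s :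
  metric_proj S z s <-> S s /\ forall t, S t -> sqn (s - z) <= sqn (t - z).
Proof.
by split=> -[Ss sP]; split=> // t /sP; rewrite /enorm ler_sqrt ?sqn_ge0.
Qed.

(** A point [t] of [S] for which the obtuse-angle inequality holds is the only
    nearest point.  It is used both for [C1] and for the faces of [C2]. *)
Lemma metric_proj_eq (R : realType) (p : nat) (S : set 'cV[R]_p) z s t :
  metric_proj S z s -> S t ->
  sqn (t - z) + sqn (s - t) <= sqn (s - z) -> s = t.
Proof.
move=> /metric_proj_sqn[_ sP] /sP tz st; apply/subr0_eq/sqn_eq0; lra.
Qed.

Lemma gram_eq0 (R : realType) (p q : nat) (X : 'M[R]_(p, q)) :
  X^T *m X = 0 -> X = 0.
Proof.
move=> X0; apply/matrixP => i k; rewrite mxE.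
have : col k X = 0; last by move/matrixP/(_ i 0); rewrite !mxE.
apply: sqn_eq0.
have -> : sqn (col k X) = (X^T *m X) k k.
  by rewrite mxE; apply: eq_bigr => l _; rewrite !mxE.
by rewrite X0 mxE.
Qed.

(** Over a real field [T] and [T *m T^T] have the same column space: if
    [x^T T T^T x = 0] then [T^T x = 0].  The factor [E] solves the normal
    equations of the projection on [T x = b], whatever the rank of [T]. *)
Lemma mulmx_trmx_factor (R : realType) (m p : nat) (T : 'M[R]_(m, p)) :
  exists E : 'M[R]_(m, p), T = T *m T^T *m E.
Proof.
have /submxP[D TD] : (T^T <= T *m T^T)%MS.
  rewrite submxE; apply/eqP/gram_eq0.
  by rewrite trmx_mul trmxK -mulmxA (mulmxA T) mulmx_coker mulmx0.
by exists D^T; apply: trmx_inj; rewrite !trmx_mul !trmxK; exact: TD.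
Qed.

(** Variational characterization of the projector on [T x = b]; as a total
    function it can be evaluated at a limit point. *)
Definition is_affine_proj (R : realType) (m p : nat) (T : 'M[R]_(m, p))
    (b : 'cV[R]_m) (P : 'cV[R]_p -> 'cV[R]_p) :=
  forall x, T *m P x = b /\ ortho_compl (kerset T) (x - P x).

Lemma affine_pythagoras (R : realType) (m p : nat) (T : 'M[R]_(m, p)) (b : 'cV[R]_m)
    (x s t : 'cV[R]_p) :
  T *m s = b -> ortho_compl (kerset T) (x - s) -> T *m t = b ->
  sqn (t - x) = sqn (s - x) + sqn (s - t).
Proof.
move=> Ts xs Tt.
have := xs (s - t); rewrite /kerset /= mulmxBr Ts Tt subrr => /(_ erefl).
rewrite !dotvE (dotvC s x) (dotvC t x) (dotvC t s); lra.
Qed.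

Lemma affine_proj (R : realType) (m p : nat) (T : 'M[R]_(m, p)) (b : 'cV[R]_m)
    (s0 : 'cV[R]_p) :
  T *m s0 = b -> exists P, is_affine_proj T b P.
Proof.
move=> Ts0; have [E TE] := mulmx_trmx_factor T.
exists (fun x => x - T^T *m (E *m (x - s0))) => x; split.
  by rewrite mulmxBr !mulmxA -TE mulmxBr Ts0 opprB addrC subrK.
move=> y; rewrite /kerset /= => Ty; rewrite opprB addrC subrK.
by rewrite dotv_trmx trmx_mul trmxK -mulmxA Ty mulmx0 mxE.
Qed.

Lemma metric_proj_affine (R : realType) (m p : nat) (T : 'M[R]_(m, p))
    (b : 'cV[R]_m) (P : 'cV[R]_p -> 'cV[R]_p) (TP : is_affine_proj T b P)
    (x s : 'cV[R]_p) :
  metric_proj [set t | T *m t = b] x s <-> s = P x.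
Proof.
have [TPx Px] := TP x; split=> [sx|->].
  apply: (metric_proj_eq (t := P x) sx) => //.
  have [/= Ts _] := sx.
  by rewrite (affine_pythagoras TPx Px Ts) (sqn_subC s).
apply/metric_proj_sqn; split=> // t Tt.
by rewrite (affine_pythagoras TPx Px Tt) lerDl sqn_ge0.
Qed.

Lemma affine_proj_ortho (R : realType) (m p : nat) (T : 'M[R]_(m, p))
    (b : 'cV[R]_m) (P : 'cV[R]_p -> 'cV[R]_p) (TP : is_affine_proj T b P)
    (x y z : 'cV[R]_p) :
  dotv (x - P x) (P y - P z) = 0.
Proof.
have [_ Px] := TP x; apply: Px.
by rewrite /kerset /= mulmxBr (TP y).1 (TP z).1 subrr.
Qed.

(** [P x - P y] is the component of [x - y] in the kernel of [T]. *)
Lemma affine_proj_nonexpansive (R : realType) (m p : nat) (T : 'M[R]_(m, p))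
    (b : 'cV[R]_m) (P : 'cV[R]_p -> 'cV[R]_p) (TP : is_affine_proj T b P)
    (x y : 'cV[R]_p) :
  sqn (P x - P y) <= sqn (x - y).
Proof.
have -> : x - y = (P x - P y) + ((x - P x) - (y - P y)).
  by apply/matrixP => i k; rewrite !mxE; ring.
have := sqn_ge0 ((x - P x) - (y - P y)).
have := affine_proj_ortho TP x x y; have := affine_proj_ortho TP y x y.
set d := P x - P y; set e := x - P x; set f := y - P y.
clearbody d e f.
rewrite !dotvE (dotvC d e) (dotvC d f) (dotvC f e); lra.
Qed.

Lemma relaxed_nonexpansive (R : realType) (m p : nat) (T : 'M[R]_(m, p))
    (b : 'cV[R]_m) (P : 'cV[R]_p -> 'cV[R]_p) (TP : is_affine_proj T b P)
    (g : R) (x y : 'cV[R]_p) : 0 <= g <= 1 ->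
  sqn (((1 - g) *: x + g *: P x) - ((1 - g) *: y + g *: P y)) <= sqn (x - y).
Proof.
move=> g01.
have -> : ((1 - g) *: x + g *: P x) - ((1 - g) *: y + g *: P y) =
          (1 - g) *: (x - y) + g *: (P x - P y).
  by apply/matrixP => i k; rewrite !mxE; ring.
have := sqn_convex (x - y) (P x - P y) g01.
have := affine_proj_nonexpansive TP x y; move/andP: g01 => [g0 g1]; nra.
Qed.

(** Put [q = y - x], [e = x - P x] and [d = P y - P x].  As [x] competes with
    [y], [sqn (q + g e) <= sqn (g e)], that is, [2 g <q, e> <= - sqn q].  As
    [e] and [e + q - d = y - P y] are orthogonal to [d], the new squared
    distance is [sqn (e + q) - sqn d], at most
    [sqn e + 2 <q, e> + sqn q <= sqn e - (1 / g - 1) sqn q]. *)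
Lemma relaxed_descent (R : realType) (m p : nat) (T : 'M[R]_(m, p))
    (b : 'cV[R]_m) (P : 'cV[R]_p -> 'cV[R]_p) (TP : is_affine_proj T b P)
    (g : R) (S : set 'cV[R]_p) (x y : 'cV[R]_p) :
  0 < g -> S x -> metric_proj S ((1 - g) *: x + g *: P x) y ->
  (1 - g) * sqn (y - x) <= g * (sqn (x - P x) - sqn (y - P y)).
Proof.
move=> g0 Sx /metric_proj_sqn[_ /(_ x Sx)].
have := affine_proj_ortho TP x y x; have := affine_proj_ortho TP y y x.
have := sqn_ge0 (P y - P x).
have -> : y - P y = (x - P x) + (y - x) - (P y - P x).
  by apply/matrixP => i k; rewrite !mxE; ring.
have -> : y - ((1 - g) *: x + g *: P x) = (y - x) + g *: (x - P x).
  by apply/matrixP => i k; rewrite !mxE; ring.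
have -> : x - ((1 - g) *: x + g *: P x) = g *: (x - P x).
  by apply/matrixP => i k; rewrite !mxE; ring.
set d := P y - P x; set e := x - P x; set q := y - x.
clearbody d e q.
rewrite !dotvE (dotvC d e) (dotvC d q) (dotvC q e).
nra.
Qed.

(** The energy [h] is nonincreasing and bounded below, so its decrements, which
    control [r], tend to 0. *)
Lemma descent_steps_cvg0 (R : realType) (a b : R) (h r : nat -> R) :
  0 < a -> 0 < b -> (forall k, 0 <= h k) -> (forall k, 0 <= r k) ->
  (forall k, a * r k <= b * (h k - h k.+1)) ->
  forall e, 0 < e -> \forall k \near \oo, r k < e.
Proof.
move=> a0 b0 h0 r0 hr e e0.
have hcvg : cvgn h.
  apply: nonincreasing_is_cvgn.
    apply/nonincreasing_seqP => k; rewrite -subr_ge0 -(pmulr_rge0 _ b0).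
    exact: le_trans (mulr_ge0 (ltW a0) (r0 k)) (hr k).
  by exists 0 => _ [k _ <-].
have d0 : (h k - h k.+1) @[k --> \oo] --> 0.
  rewrite -(subrr (limn h)); apply: cvgB => //.
  by have := hcvg; rewrite -(cvg_shiftS h).
have ae : 0 < a * e / b by rewrite divr_gt0// mulr_gt0.
move/cvgrPdist_lt: d0 => /(_ _ ae); apply: filterS => k /=.
rewrite sub0r normrN => /(le_lt_trans (ler_norm _)) hk; rewrite -(ltr_pM2l a0).
by apply: le_lt_trans (hr k) _; rewrite mulrC -ltr_pdivlMr.
Qed.

(** * Faces of the orthant and the complementarity set *)

(** The projector on the face of the nonnegative orthant whose points vanish
    outside [S]. *)
Definition clip (R : realType) (p : nat) (S : {set 'I_p}) (y : 'cV[R]_p) :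
    'cV[R]_p :=
  \col_i (if i \in S then Num.max (y i 0) 0 else 0).

Definition supp (R : realType) (p : nat) (x : 'cV[R]_p) : {set 'I_p} :=
  [set i | x i 0 != 0]%SET.

Lemma clip_nonexpansive (R : realType) (p : nat) (S : {set 'I_p})
    (x y : 'cV[R]_p) :
  sqn (clip S x - clip S y) <= sqn (x - y).
Proof.
apply: ler_sum => i _; rewrite !mxE -!expr2.
case: ifP => _; last by rewrite subrr expr0n /= sqr_ge0.
case: (leP (x i 0) 0) => hx; case: (leP (y i 0) 0) => hy //.
- by rewrite subrr expr0n /= sqr_ge0.
- have := mulr_le0_ge0 hx (ltW hy); have := sqr_ge0 (x i 0); lra.
- have := mulr_ge0_le0 (ltW hx) hy; have := sqr_ge0 (y i 0); lra.
Qed.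

(** The obtuse-angle inequality of the projector [clip (supp t)], at the point
    [t] of its face. *)
Lemma clip_obtuse (R : realType) (p : nat) (t y : 'cV[R]_p) :
  (forall i, 0 <= t i 0) ->
  sqn (clip (supp t) y - y) + sqn (t - clip (supp t) y) <= sqn (t - y).
Proof.
move=> t0; rewrite /dotv -big_split; apply: ler_sum => i _ /=.
rewrite !mxE -!expr2 inE; have := t0 i.
case: eqP => [-> _|_ ti] /=; first by rewrite subrr expr0n /= addr0.
case: (leP (y i 0) 0) => hy; nra.
Qed.

Lemma C2P (R : realType) (n : nat) (z : 'cV[R]_(n + n)) :
  C2 z <-> (forall i, 0 <= z i 0) /\
    (forall i : 'I_n, z (lshift n i) 0 * z (rshift n i) 0 = 0).
Proof.
split=> [[u0 v0 uv]|[z0 zz]].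
  split=> i.
    rewrite -(splitK i); case: (fintype.split i) => j /=.
      by have := u0 j; rewrite mxE.
    by have := v0 j; rewrite mxE.
  move/eqP: uv; rewrite /dotv psumr_eq0 => [|j _]; last by rewrite mulr_ge0.
  by move=> /allP/(_ i (mem_index_enum _))/eqP; rewrite !mxE.
split=> [i|i|]; rewrite ?mxE//.
by rewrite /dotv big1// => i _; rewrite !mxE.
Qed.

(** The face spanned by the support of a point of [C2] lies in [C2], which is
    therefore a union of faces. *)
Lemma clip_C2 (R : realType) (n : nat) (z y : 'cV[R]_(n + n)) :
  C2 z -> C2 (clip (supp z) y).
Proof.
move=> /C2P[_ zz]; apply/C2P; split=> i; rewrite !mxE.
  by case: ifP => // _; rewrite le_max lexx orbT.
rewrite !inE; have /eqP := zz i; rewrite mulf_eq0.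
by case/orP=> -> /=; rewrite ?mul0r ?mulr0.
Qed.

(** A nearest point of [C2] is nearest in its own face, where the projection is
    unique. *)
Lemma metric_proj_C2 (R : realType) (n : nat) (z y : 'cV[R]_(n + n)) :
  metric_proj (@C2 R n) y z -> z = clip (supp z) y.
Proof.
move=> zy; have [Cz _] := zy; apply: (metric_proj_eq zy (clip_C2 y Cz)).
by apply: clip_obtuse; case/C2P: Cz.
Qed.

(** * Convergence of the relaxed alternating projections *)

Unset Implicit Arguments.

Theorem theorem3p20 (R : realType) (m n : nat) (A B : 'M[R]_(m, n))
    (c : 'cV[R]_m) (gamma : R) (hgamma : 0 < gamma < 1)
    (w : nat -> 'cV[R]_(n + n))
    (hw0 : exists2 wb0, C2 wb0 & relaxed_proj gamma (C1 A B c) wb0 (w 0%N))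
    (hw : forall k : nat, exists2 wb, metric_proj (@C2 R n) (w k) wb &
            relaxed_proj gamma (C1 A B c) wb (w k.+1))
    (hbounded : bounded_set (range w)) :
  exists wb ws : 'cV[R]_(n + n),
    [/\ C2 wb,
        relaxed_proj gamma (C1 A B c) wb ws,
        w @ \oo --> ws
      & ortho_compl (kerset (Tmx A B)) `&`
          [set z : 'cV[R]_(n + n) |
            forall i : 'I_n, usubmx z i 0 * dsubmx z i 0 = 0] = [set 0] ->
        (forall i : 'I_n, (usubmx wb i 0, dsubmx wb i 0) <> (0, 0)) ->
        (C1 A B c `&` @C2 R n) ws].
Proof.
have /andP[g0 g1] := hgamma.
have [wb0 _ [s0 [Ts0 _] _]] := hw0.
have [P TP] := affine_proj Ts0.
pose G x := (1 - gamma) *: x + gamma *: P x.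
have relE x y : relaxed_proj gamma (C1 A B c) x y <-> y = G x.
  split=> [[s /(metric_proj_affine TP) -> <-]//|->].
  by exists (P x) => //; apply/(metric_proj_affine TP).
have [z zP] : {z : nat -> 'cV[R]_(n + n) & forall k,
    metric_proj (@C2 R n) (w k) (z k) /\ w k.+1 = G (z k)}.
  apply: (@boolp.choice _ _ (fun k x => metric_proj (@C2 R n) (w k) x /\
    w k.+1 = G x)) => k.
  by have [x wx /relE xw] := hw k; exists x.
have zC k : C2 (z k) by have [[]] := zP k.
have zclip k : z k = clip (supp (z k)) (w k) by apply/metric_proj_C2/(zP k).1.
have Gne x y : sqn (G x - G y) <= sqn (x - y).
  by apply: relaxed_nonexpansive TP _ _ _ _; rewrite !ltW.
have zstep : forall e, 0 < e -> \forall k \near \oo, sqn (z k.+1 - z k) < e.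
  apply: (@descent_steps_cvg0 _ (1 - gamma) gamma
    (fun k => sqn (z k - P (z k)))).
  - by rewrite subr_gt0.
  - by [].
  - by move=> k; apply: sqn_ge0.
  - by move=> k; apply: sqn_ge0.
  move=> k; apply: (relaxed_descent TP g0 (zC k)).
  by have [] := zP k.+1; have [_ ->] := zP k.
have [M zM] : exists M, forall k i, `|z k i 0| <= M.
  have [M [_ MP]] := hbounded; exists (M + 1) => k i.
  have wM : `|w k| <= M + 1 by apply: MP; [rewrite ltrDl|exists k].
  rewrite zclip mxE; case: ifP => _; last first.
    by rewrite normr0; apply: le_trans wM.
  have wi : `|w k i 0| <= M + 1.
    apply: le_trans wM; rewrite [leRHS]mx_normrE.
    by apply: (le_bigmax _ (fun ij => `|w k ij.1 ij.2|) (i, 0)).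
  by case: (leP (w k i 0) 0) => // _; rewrite normr0; apply: le_trans wi.
have [zs zcl] := bounded_sqn_cluster zM.
have [||zlim [k0 zfix]] := union_nonexpansive_cvg
  (F := fun S x => clip S (G x)) (j := fun k => supp (z k.+1)) _ _ zstep zcl.
- by move=> S x y; apply: le_trans (clip_nonexpansive _ _ _) (Gne x y).
- by move=> k; rewrite {1}zclip (zP k).2.
(* The fixing map is one of those applied, so its face is spanned by the
   support of a point of C2. *)
have zsC : C2 zs by rewrite -zfix; apply: clip_C2.
exists zs, (G zs); split=> //; first exact/relE.
  rewrite -cvg_shiftS; apply: cvg_sqn => e /zlim.
  by apply: filterS => k /=; rewrite (zP k).2; apply: le_lt_trans.
move=> ker0 znz.
have : [set 0] (zs - P zs).
  rewrite -ker0; split; first exact: (TP zs).2.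
  move=> i /=; have /C2P[z0 _] := zsC.
  (* At a positive coordinate zs is not clipped: zs = zs - gamma (zs - P zs). *)
  have res j : zs j 0 != 0 -> (zs - P zs) j 0 = 0.
    move=> zj; have := congr1 (fun x : 'cV_(n + n) => x j 0) zfix.
    have := z0 j; rewrite /G !mxE; case: ifP => _; last first.
      by move=> _ zj0; rewrite -zj0 eqxx in zj.
    case: (leP _ 0) => _; first by move=> _ zj0; rewrite -zj0 eqxx in zj.
    move=> _ H; apply: (mulfI (lt0r_neq0 g0)); lra.
  move: (zs - P zs) res => e res; have := znz i; rewrite !mxE.
  have [->|/res -> _] := eqVneq (zs (lshift n i) 0) 0; last by rewrite mul0r.
  have [->|/res -> _] := eqVneq (zs (rshift n i) 0) 0; last by rewrite mulr0.
  by case.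
move=> /subr0_eq zP0.
have -> : G zs = zs by rewrite /G -zP0 -scalerDl subrK scale1r.
by split => //; rewrite zP0; exact: (TP zs).1.
Qed.
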